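(* Let $n\ge2$ be an integer, let $C_1,C_2,s>0$, and let $y_1,\dots,y_n$ be real numbers with $C_1 i^{-2s}\le y_i\le C_2 i^{-2s}$ for $i=1,\dots,n$. Set $\omega_i=1/(H_n i)$ for $i=1,\dots,n$, where $H_n=\sum_{i=1}^n 1/i$ is the $n$-th harmonic number. Applying weighted linear least squares in the log-log scale with weights $\omega_i$ and points $x_i=\log i$, i.e. minimizing $$\sum_{i=1}^n\omega_i\,\big|\log(y_i)-\log(D\,i^{-2t})\big|^2$$ over $D>0$ and $t\in\mathbb R$, yields the approximated decay behavior $D\,i^{-2t}$ with $$D=\exp\left(\frac{\big(\sum_{i=1}^n\omega_i\log^2(i)\big)\big(\sum_{i=1}^n\omega_i\log(y_i)\big)-\big(\sum_{i=1}^n\omega_i\log(i)\log(y_i)\big)\big(\sum_{i=1}^n\omega_i\log(i)\big)}{\big(\sum_{i=1}^n\omega_i\log^2(i)\big)-\big(\sum_{i=1}^n\omega_i\log(i)\big)^2}\right)$$ and $$t=-\frac12\,\frac{\big(\sum_{i=1}^n\omega_i\log(i)\log(y_i)\big)-\big(\sum_{i=1}^n\omega_i\log(i)\big)\big(\sum_{i=1}^n\omega_i\log(y_i)\big)}{\big(\sum_{i=1}^n\omega_i\log^2(i)\big)-\big(\sum_{i=1}^n\omega_i\log(i)\big)^2}.$$ If moreover $n\ge3$, then $$|t-s|\ \le\ \frac{4\log(C_2/C_1)}{\log n}$$ and $$\log C_1-4\log\Big(\frac{C_2}{C_1}\Big)\ \le\ \log(D)\ \le\ \log C_2+4\log\B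ig(\frac{C_2}{C_1}\Big).$$
   Context: $\log$ is the natural logarithm and $\log^2(i)=(\log i)^2$. *)

(* Defs.v *)
From HB Require Import structures.
From mathcomp Require Import all_boot all_order all_algebra.
From mathcomp Require Import all_classical all_reals all_analysis.

Set Implicit Arguments.
Unset Strict Implicit.
Unset Printing Implicit Defensive.

Import Order.TTheory GRing.Theory Num.Theory.

Local Open Scope ring_scope.

Definition harmonic_number (R : realType) (n : nat) : R :=
  \sum_(1 <= i < n.+1) 1 / i%:R.

Definition omega (R : realType) (n i : nat) : R :=
  1 / (harmonic_number R n * i%:R).

Definition wsum (R : realType) (n : nat) (f : nat -> R) : R :=
  \sum_(1 <= i < n.+1) omega R n i * f i.

(* Only the values y 1, ..., y n are used. *)
Definition loglog_objective (R : realType) (n : nat) (y : nat -> R) (D t : R)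
    : R :=
  wsum n (fun i => `|ln (y i) - ln (D * i%:R `^ (- 2 * t))| ^+ 2).

Definition loglog_minimizer (R : realType) (n : nat) (y : nat -> R) (D t : R)
    : Prop :=
  0 < D /\
  forall D' t' : R, 0 < D' ->
    loglog_objective n y D t <= loglog_objective n y D' t'.

(* Main.v *)
(** Write L_i = log i and let A, V be the mean and variance of L under the
    weights.  The objective, as a function of (log D, t), is its value at the
    claimed minimizer (d_0, t_0) plus
    (d - d_0 - 2 A (t - t_0))^2 + 4 V (t - t_0)^2, and V > 0.
    The residuals r_i = log y_i + 2 s L_i - (log C1 + log C2)/2 satisfy
    |r_i| <= Delta/2 with Delta = log (C2/C1), and t - s = - Cov(L, r)/(2 V),
    so Cauchy-Schwarz gives (t - s)^2 <= Delta^2/(16 V).  The constant 4 then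
    follows from V >= (log n)^2/256, and, as
    log D = E r + (log C1 + log C2)/2 + 2 (t - s) A, the bound on log D follows
    from A <= (log n)/2.  Both moment estimates are proved by induction on n,
    for the unnormalized sums, from 1/(n+1) <= log(n+1) - log n <= 1/n. *)

Require Import Defs.
From HB Require Import structures.
From mathcomp Require Import all_boot all_order all_algebra.
From mathcomp Require Import all_classical all_reals all_analysis.
From mathcomp Require Import ring lra.

Set Implicit Arguments.
Unset Strict Implicit.
Unset Printing Implicit Defensive.

Import Order.TTheory GRing.Theory Num.Theory.

Local Open Scope ring_scope.

(** Passing from n to n+1 adds a single term here, whereas every normalized weight [omega] changes;
    inductions on n are therefore run on these sums. *)
Definition hsum (R : realType) (n : nat) (f : nat -> R) : R :=
  \sum_(1 <= i < n.+1) f i / i%:R.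

Lemma hsumS (R : realType) (n : nat) (f : nat -> R) :
  hsum n.+1 f = hsum n f + f n.+1 / n.+1%:R.
Proof. by rewrite /hsum big_nat_recr. Qed.

Lemma hsum0 (R : realType) (f : nat -> R) : hsum 0 f = 0.
Proof. by rewrite /hsum big_geq. Qed.

(** * Harmonic numbers compared with the logarithm *)

Lemma harmonic_numberS (R : realType) (n : nat) :
  harmonic_number R n.+1 = harmonic_number R n + n.+1%:R^-1.
Proof. by rewrite /harmonic_number big_nat_recr //= div1r. Qed.

Lemma harmonic_number0 (R : realType) : harmonic_number R 0 = 0.
Proof. by rewrite /harmonic_number big_geq. Qed.

Lemma ln_succ_sub_le (R : realType) (n : nat) : (0 < n)%N ->
  ln n.+1%:R - ln n%:R <= n%:R^-1 :> R.
Proof.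
move=> n0; have n0R : 0 < n%:R :> R by rewrite ltr0n.
rewrite -ln_div ?posrE ?ltr0n // -[n.+1]addn1 natrD mulrDl divff ?gt_eqF //.
rewrite mul1r; apply: le_ln1Dx; apply: lt_trans (_ : 0 < _); first by lra.
by rewrite invr_gt0.
Qed.

(** The inequality log(1+x) <= x again, now at x = -1/(n+1), since n/(n+1) = 1 - 1/(n+1). *)
Lemma ln_succ_sub_ge (R : realType) (n : nat) : (0 < n)%N ->
  n.+1%:R^-1 <= ln n.+1%:R - ln n%:R :> R.
Proof.
move=> n0; have n0R : 0 < n%:R :> R by rewrite ltr0n.
have n1R : 0 < n.+1%:R :> R by rewrite ltr0n.
have -> : ln n.+1%:R - ln n%:R = - ln (n%:R / n.+1%:R) :> R.
  by rewrite ln_div ?posrE // opprB.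
have -> : n%:R / n.+1%:R = 1 + - n.+1%:R^-1 :> R.
  by rewrite -natr1; field; rewrite natr1 gt_eqF.
rewrite lerNr; apply: le_ln1Dx.
by rewrite ltrN2 invf_lt1 // ltr1n.
Qed.

Lemma ln_succ_le_harmonic (R : realType) (n : nat) :
  ln n.+1%:R <= harmonic_number R n.
Proof.
elim: n => [|n IH]; first by rewrite ln1 harmonic_number0.
have := @ln_succ_sub_le R n.+1 isT; rewrite harmonic_numberS lerBlDl => h.
by apply: le_trans h _; rewrite lerD2r.
Qed.

Lemma harmonic_le_1Dln (R : realType) (n : nat) : (0 < n)%N ->
  harmonic_number R n <= 1 + ln n%:R.
Proof.
case: n => // n _; elim: n => [|n IH].
  by rewrite harmonic_numberS harmonic_number0 ln1 invr1; lra.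
have := @ln_succ_sub_ge R n.+1 isT; rewrite harmonic_numberS lerBrDr => h.
rewrite (le_trans (lerD IH (lexx _)))// -addrA lerD2l addrC.
exact: h.
Qed.

Lemma harmonic_ge1 (R : realType) (n : nat) : (0 < n)%N ->
  1 <= harmonic_number R n.
Proof.
case: n => // n _; elim: n => [|n IH].
  by rewrite harmonic_numberS harmonic_number0 invr1 add0r.
by rewrite harmonic_numberS (le_trans IH)// lerDl invr_ge0 ler0n.
Qed.

(** * First and second moments of the logarithm under the weights 1/i *)

Lemma hsum_ln_le (R : realType) (n : nat) : (0 < n)%N ->
  hsum n (fun i => ln i%:R) <= ln n%:R * harmonic_number R n / 2.
Proof.
case: n => // n _; elim: n => [|n IH].
  by rewrite hsumS hsum0 ln1 !mul0r addr0.
rewrite hsumS harmonic_numberS.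
have dge := @ln_succ_sub_ge R n.+1 isT.
have Hge := ln_succ_le_harmonic R n.+1.
have l0 : 0 <= ln n.+2%:R :> R by rewrite ln_ge0 // ler1n.
have u0 : 0 < n.+2%:R^-1 :> R by rewrite invr_gt0 ltr0n.
move: dge Hge l0 u0 IH; move: (ln n.+2%:R) (ln n.+1%:R) (harmonic_number _ _)
  (n.+2%:R^-1 : R) (hsum _ _) => l' l H u S dge Hge l0 u0 IH.
(* The induction hypothesis reduces the goal to this product of [l' <= H] and [u <= l' - l]. *)
have h1 : l' * u <= H * (l' - l).
  by apply: ler_pM => //; lra.
nra.
Qed.

(* The bound on [S1] makes the new point [l'] lie at distance at least [l' / 2]
   from the mean [S1 / H] of the previous ones. *)
Lemma dispersion_step (R : realFieldType) (H S1 S2 l l' u : R) :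
  1 <= H -> H <= 3 * l' -> 0 < u -> u <= 1 / 2 ->
  0 <= l -> l <= l' -> l' - l <= 2 * u -> 0 < l' -> S1 <= l * H / 2 ->
  (H * l) ^+ 2 <= 256 * (H * S2 - S1 ^+ 2) ->
  ((H + u) * l') ^+ 2
    <= 256 * ((H + u) * (S2 + l' ^+ 2 * u) - (S1 + l' * u) ^+ 2).
Proof.
move=> H1 Hl u0 u1 l0 ll' d2 l'0 hS IH.
(* For harmonic sums, [G] is the sum of (l' - L_i)^2 / i over the previous points; adding the new
   point raises the dispersion by exactly [u * G]. *)
set G := l' ^+ 2 * H + S2 - 2 * l' * S1.
have V0 : 0 <= H * S2 - S1 ^+ 2.
  by have := sqr_ge0 (H * l); lra.
have lH : l * H <= l' * H by rewrite ler_wpM2r//; lra.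
have l'H : 0 <= l' * H by rewrite mulr_ge0//; lra.
have G4 : l' ^+ 2 * H / 4 <= G.
  have sq : (l' * H / 2) ^+ 2 <= (l' * H - S1) ^+ 2.
    by rewrite ler_sqr ?nnegrE; lra.
  rewrite -(@ler_pM2r _ H); last by lra.
  have -> : G * H = (l' * H - S1) ^+ 2 + (H * S2 - S1 ^+ 2) by rewrite /G; ring.
  have -> : l' ^+ 2 * H / 4 * H = (l' * H / 2) ^+ 2 by field.
  lra.
have -> : (H + u) * (S2 + l' ^+ 2 * u) - (S1 + l' * u) ^+ 2
    = H * S2 - S1 ^+ 2 + u * G by rewrite /G; ring.
have uG : u * (l' ^+ 2 * H / 4) <= u * G by rewrite ler_pM2l.
suff : ((H + u) * l') ^+ 2 - (H * l) ^+ 2 <= u * (64 * l' ^+ 2 * H) by lra.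
rewrite subr_sqr.
(* The difference factor is [H * (l' - l) + u * l'], at most 6ul' + ul'; the sum factor has three
   terms, each at most [H * l']. The product 21 stays below 64 = 256/4. *)
apply: le_trans (_ : (7 * u * l') * (3 * (H * l')) <= _).
  have a0 : 0 <= H * l by rewrite mulr_ge0//; lra.
  have b0 : H * l <= H * l' by rewrite ler_wpM2l//; lra.
  have c0 : u * l' <= H * l' by rewrite ler_wpM2r//; lra.
  apply: ler_pM.
  - by rewrite subr_ge0; nra.
  - by nra.
  - have e1 : H * (l' - l) <= (3 * l') * (2 * u) by apply: ler_pM; lra.
    lra.
  - lra.
have : 0 <= u * (l' ^+ 2 * H) by rewrite !mulr_ge0 // ?sqr_ge0; lra.
nra.
Qed.

(** This is the variance bound multiplied by H_n^2, which keeps the induction step free of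
    quotients. The factor 256 = 16^2 is what the final constant 4 requires: |t - s| <= Delta/(4 sqrt
    V) and sqrt V >= (log n)/16. *)
Lemma hsum_ln_dispersion (R : realType) (n : nat) : (0 < n)%N ->
  (harmonic_number R n * ln n%:R) ^+ 2 <=
  256 * (harmonic_number R n * hsum n (fun i => ln i%:R ^+ 2)
         - hsum n (fun i => ln i%:R) ^+ 2).
Proof.
case: n => // n _; elim: n => [|n IH].
  rewrite !hsumS !hsum0 ln1.
  by rewrite !expr2 !(mul0r, mulr0, addr0, subr0).
have dge := @ln_succ_sub_ge R n.+1 isT.
have dle := @ln_succ_sub_le R n.+1 isT.
have l0 : 0 <= ln n.+1%:R :> R by rewrite ln_ge0 // ler1n.
have u0 : 0 < n.+2%:R^-1 :> R by rewrite invr_gt0 ltr0n.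
have u2 : n.+2%:R^-1 <= 1 / 2 :> R.
  by rewrite div1r lef_pV2 ?posrE ?ltr0n // ler_nat.
(* Thus 1 <= 2 log(n+2), which turns H <= 1 + log(n+1) into H <= 3 log(n+2). *)
have l2 : 1 / 2 <= ln n.+2%:R :> R.
  have := @ln_succ_sub_ge R 1 isT; rewrite ln1 subr0 => h.
  apply: (le_trans (y := ln 2%:R)); first by rewrite div1r.
  by rewrite ler_ln ?posrE ?ltr0n // ler_nat.
have Hle := @harmonic_le_1Dln R n.+1 isT.
have l12 : ln n.+1%:R <= ln n.+2%:R :> R.
  by rewrite ler_ln ?posrE ?ltr0n // ler_nat.
have H3 : harmonic_number R n.+1 <= 3 * ln n.+2%:R.
  by apply: (le_trans Hle); move: l12 l2; move: (ln _) (ln _) => a b; lra.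
rewrite [in leRHS]hsumS [in X in _ - X]hsumS [in leRHS]harmonic_numberS.
rewrite [in leLHS]harmonic_numberS.
apply: dispersion_step IH; rewrite ?harmonic_ge1 //; try lra.
  (* The increment of the logarithm is at most 1/(n+1), and 1/(n+1) <= 2/(n+2). *)
  apply: le_trans dle _.
  rewrite -(@ler_pM2l _ n.+1%:R) ?ltr0n // divff ?pnatr_eq0 //.
  rewrite mulrA -(@ler_pM2r _ n.+2%:R) ?ltr0n // divfK ?pnatr_eq0 //.
  rewrite mul1r mulrC -natrM ler_nat mul2n -addnn.
  by rewrite addSn !addnS !ltnS leq_addr.
exact: hsum_ln_le.
Qed.

(** * Weighted means *)

Lemma wsum_hsum (R : realType) (n : nat) (f : nat -> R) :
  wsum n f = hsum n f / harmonic_number R n.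
Proof.
rewrite /wsum /hsum /omega mulr_suml; apply: eq_bigr => i _.
by rewrite div1r invfM; ring.
Qed.

Lemma eq_wsum (R : realType) (n : nat) (f g : nat -> R) :
  (forall i, (1 <= i <= n)%N -> f i = g i) -> wsum n f = wsum n g.
Proof. by move=> fg; apply: eq_big_nat => i ?; rewrite fg. Qed.

Lemma wsumD (R : realType) (n : nat) (f g : nat -> R) :
  wsum n (fun i => f i + g i) = wsum n f + wsum n g.
Proof.
by rewrite /wsum -big_split; apply: eq_bigr => i _; rewrite mulrDr.
Qed.

Lemma wsumZ (R : realType) (n : nat) (c : R) (f : nat -> R) :
  wsum n (fun i => c * f i) = c * wsum n f.
Proof.
by rewrite /wsum mulr_sumr; apply: eq_bigr => i _; rewrite mulrCA.
Qed.

Lemma wsum1 (R : realType) (n : nat) : (0 < n)%N -> wsum n (fun=> 1 : R) = 1.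
Proof.
move=> n0; rewrite wsum_hsum divff // gt_eqF //.
exact: lt_le_trans ltr01 (harmonic_ge1 R n0).
Qed.

Lemma wsum_le (R : realType) (n : nat) (f g : nat -> R) :
  (forall i, (1 <= i <= n)%N -> f i <= g i) -> wsum n f <= wsum n g.
Proof.
case: n => [|n] fg; first by rewrite /wsum !big_geq.
apply: ler_sum_nat => i ?; rewrite ler_wpM2l ?fg // /omega div1r invr_ge0.
by rewrite mulr_ge0 ?ler0n // (le_trans ler01) ?harmonic_ge1.
Qed.

Lemma wsum_cst (R : realType) (n : nat) (c : R) : (0 < n)%N ->
  wsum n (fun=> c) = c.
Proof.
move=> n0; rewrite -[RHS]mulr1 -(wsum1 R n0) -wsumZ.
by apply: eq_wsum => i _; rewrite mulr1.
Qed.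

(** The mean of (P f - F g)^2 is nonnegative and expands to F (F G - P^2); dividing by F > 0 gives
    the claim. *)
Lemma wsum_cauchy_schwarz (R : realType) (n : nat) (f g : nat -> R) :
  0 < wsum n (fun i => f i ^+ 2) ->
  wsum n (fun i => f i * g i) ^+ 2
    <= wsum n (fun i => f i ^+ 2) * wsum n (fun i => g i ^+ 2).
Proof.
set F := wsum n _; set P := wsum n (fun i => f i * g i).
set G := wsum n _ => F0.
have : 0 <= wsum n (fun i => (P * f i - F * g i) ^+ 2).
  have <- : wsum n (fun=> 0 : R) = 0.
    by rewrite /wsum big1 // => i _; rewrite mulr0.
  by apply: wsum_le => i _; exact: sqr_ge0.
rewrite (@eq_wsum _ _ _ (fun i => P ^+ 2 * f i ^+ 2
  + ((- 2 * P * F) * (f i * g i) + F ^+ 2 * g i ^+ 2))); last first.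
  by move=> i _; ring.
rewrite !wsumD !wsumZ -/F -/P -/G.
have -> : P ^+ 2 * F + (- 2 * P * F * P + F ^+ 2 * G) = F * (F * G - P ^+ 2).
  by ring.
by rewrite pmulr_rge0 // subr_ge0.
Qed.

Lemma wsum_ln_le (R : realType) (n : nat) : (0 < n)%N ->
  wsum n (fun i => ln i%:R) <= ln n%:R / 2 :> R.
Proof.
move=> n0; have H0 := lt_le_trans ltr01 (harmonic_ge1 R n0).
rewrite wsum_hsum ler_pdivrMr // mulrAC; exact: hsum_ln_le.
Qed.

Lemma wsum_ln_ge0 (R : realType) (n : nat) :
  0 <= wsum n (fun i => ln i%:R) :> R.
Proof.
have <- : wsum n (fun=> 0 : R) = 0.
  by rewrite /wsum big1 // => i _; rewrite mulr0.
by apply: wsum_le => i /andP[i1 _]; rewrite ln_ge0 // ler1n.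
Qed.

Lemma wsum_ln_variance_ge (R : realType) (n : nat) : (0 < n)%N ->
  ln n%:R ^+ 2 <= 256 * (wsum n (fun i => ln i%:R ^+ 2)
                          - wsum n (fun i => ln i%:R) ^+ 2) :> R.
Proof.
move=> n0; have H0 := lt_le_trans ltr01 (harmonic_ge1 R n0).
rewrite !wsum_hsum -(@ler_pM2l _ (harmonic_number R n ^+ 2)) ?exprn_gt0 //.
rewrite -exprMn (le_trans (hsum_ln_dispersion R n0)) // le_eqVlt.
by apply/orP; left; apply/eqP; field; rewrite gt_eqF.
Qed.

(** * The objective as a quadratic in (log D, t), and its minimizer *)

Lemma loglog_objectiveE (R : realType) (n : nat) (y : nat -> R) (D t : R) :
  (0 < n)%N -> 0 < D ->
  loglog_objective n y D t =
    wsum n (fun i => ln (y i) ^+ 2) + ln D ^+ 2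
    + 4 * t ^+ 2 * wsum n (fun i => ln i%:R ^+ 2)
    - 2 * ln D * wsum n (fun i => ln (y i))
    + 4 * t * wsum n (fun i => ln i%:R * ln (y i))
    - 4 * ln D * t * wsum n (fun i => ln i%:R).
Proof.
move=> n0 D0; rewrite /loglog_objective.
rewrite (@eq_wsum _ _ _ (fun i => ln (y i) ^+ 2 + (ln D ^+ 2
  + (4 * t ^+ 2 * ln i%:R ^+ 2 + (- 2 * ln D * ln (y i)
  + (4 * t * (ln i%:R * ln (y i)) + (- 4 * ln D * t) * ln i%:R)))))).
  by rewrite !(wsumD, wsumZ) wsum_cst //; ring.
move=> i /andP[i1 _].
rewrite lnM ?posrE ?powR_gt0 ?ltr0n // ln_powR real_normK ?num_real //; ring.
Qed.

(** The letters P, A, B, C, E stand for the means of (log y)^2, L, L^2, L log y and log y; ([d0],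
    [t0]) solves the normal equations, so no linear terms remain around it. *)
Lemma lsq_complete_square (R : realFieldType) (P A B C E d t : R) :
  B - A ^+ 2 != 0 ->
  let q d t := P + d ^+ 2 + 4 * t ^+ 2 * B - 2 * d * E + 4 * t * C
               - 4 * d * t * A in
  let d0 := (B * E - C * A) / (B - A ^+ 2) in
  let t0 := - (1 / 2) * ((C - A * E) / (B - A ^+ 2)) in
  q d t = q d0 t0 + ((d - d0) - 2 * A * (t - t0)) ^+ 2
          + 4 * (B - A ^+ 2) * (t - t0) ^+ 2.
Proof. by move=> V0; rewrite /=; field. Qed.

Lemma loglog_minimizerP (R : realType) (n : nat) (y : nat -> R) (D t : R) :
  (2 <= n)%N ->
  let A := wsum n (fun i => ln i%:R) in
  let B := wsum n (fun i => ln i%:R ^+ 2) in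
  let C := wsum n (fun i => ln i%:R * ln (y i)) in
  let E := wsum n (fun i => ln (y i)) in
  loglog_minimizer n y D t <->
  D = expR ((B * E - C * A) / (B - A ^+ 2)) /\
  t = - (1 / 2) * ((C - A * E) / (B - A ^+ 2)).
Proof.
move=> n2 A B C E; have n0 := ltnW n2.
(* Here n >= 2 enters: log n > 0 makes the variance bound strict. *)
have V0 : 0 < B - A ^+ 2.
  have := wsum_ln_variance_ge R n0; rewrite -/A -/B.
  have : 0 < ln n%:R ^+ 2 :> R by rewrite exprn_gt0 // ln_gt0 // ltr1n.
  lra.
have qE := lsq_complete_square (wsum n (fun i => ln (y i) ^+ 2)) C E _ _
  (lt0r_neq0 V0).
split=> [[D0 /(_ (expR ((B * E - C * A) / (B - A ^+ 2)))
    (- (1 / 2) * ((C - A * E) / (B - A ^+ 2))))]|[-> ->]].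
  rewrite expR_gt0 !loglog_objectiveE ?expR_gt0 // expRK => /(_ isT).
  rewrite -/A -/B -/C -/E qE /=.
  set d0 := (_ - C * A) / _; set t0 := - (1 / 2) * _.
  (* Comparison with ([d0], [t0]) forces the sum of the two nonnegative terms to be at most 0, so
     both vanish: the second gives t = t0 because V > 0, then the first gives log D = d0. *)
  rewrite -addrA gerDl => le0.
  have a0 := sqr_ge0 (ln D - d0 - 2 * A * (t - t0)).
  have b0 : 0 <= 4 * (B - A ^+ 2) * (t - t0) ^+ 2.
    by rewrite mulr_ge0 ?sqr_ge0 // mulr_ge0 // ltW.
  have : (ln D - d0 - 2 * A * (t - t0)) ^+ 2
      + 4 * (B - A ^+ 2) * (t - t0) ^+ 2 == 0 by rewrite eq_le le0 addr_ge0.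
  rewrite paddr_eq0 // sqrf_eq0 mulf_eq0 sqrf_eq0.
  rewrite [4 * _ == 0]gt_eqF ?mulr_gt0 //=.
  move=> /andP[+ /eqP tt0]; rewrite tt0 mulr0 subr0 subr_eq0 => /eqP dd0.
  by split; [rewrite -dd0 lnK | apply/eqP; rewrite -subr_eq0 tt0].
split=> [|D' t' D'0]; first exact: expR_gt0.
rewrite !loglog_objectiveE ?expR_gt0 // expRK -/A -/B -/C -/E.
rewrite [leRHS]qE /= -[leRHS]addrA lerDl.
by rewrite addr_ge0 ?sqr_ge0 // mulr_ge0 ?sqr_ge0 // mulr_ge0 // ltW.
Qed.

Theorem theorem3p3 (R : realType) (n : nat) (C1 C2 s : R) (y : nat -> R)
    (hn : (2 <= n)%N) (hC1 : 0 < C1) (hC2 : 0 < C2) (hs : 0 < s)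
    (hy : forall i : nat, (1 <= i <= n)%N ->
       C1 * i%:R `^ (- 2 * s) <= y i <= C2 * i%:R `^ (- 2 * s)) :
  (forall D t : R,
     loglog_minimizer n y D t <->
     D = expR
           ((wsum n (fun i => ln i%:R ^+ 2) * wsum n (fun i => ln (y i))
             - wsum n (fun i => ln i%:R * ln (y i)) * wsum n (fun i => ln i%:R))
            / (wsum n (fun i => ln i%:R ^+ 2) - wsum n (fun i => ln i%:R) ^+ 2))
     /\
     t = - (1 / 2)
         * ((wsum n (fun i => ln i%:R * ln (y i))
             - wsum n (fun i => ln i%:R) * wsum n (fun i => ln (y i)))
            / (wsum n (fun i => ln i%:R ^+ 2) - wsum n (fun i => ln i%:R) ^+ 2)))
  /\
  ((3 <= n)%N ->
   forall D t : R,
     loglog_minimizer n y D t ->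
     `|t - s| <= 4 * ln (C2 / C1) / ln n%:R
     /\
     ln C1 - 4 * ln (C2 / C1) <= ln D <= ln C2 + 4 * ln (C2 / C1)).
Proof.
split=> [D t|_ D t]; first exact: loglog_minimizerP.
move=> /loglog_minimizerP -/(_ hn).
set A := wsum n (fun i => ln i%:R); set B := wsum n (fun i => ln i%:R ^+ 2).
set C := wsum n (fun i => ln i%:R * ln (y i)).
set E := wsum n (fun i => ln (y i)) => -[-> ht].
rewrite expRK ln_div ?posrE //.
set d := (_ - C * A) / _; set c1 := ln C1; set c2 := ln C2.
have n0 := ltnW hn.
have l0 : 0 < ln n%:R :> R by rewrite ln_gt0 // ltr1n.
have A2 : A <= ln n%:R / 2 := wsum_ln_le R n0.
have A0 : 0 <= A := wsum_ln_ge0 R n.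
have V256 : ln n%:R ^+ 2 <= 256 * (B - A ^+ 2) := wsum_ln_variance_ge R n0.
have V0 : 0 < B - A ^+ 2 by have := exprn_gt0 2 l0; lra.
(* Centring at the midpoint of [c1, c2] makes the bound on |r_i| half the length of that
   interval. *)
pose r (i : nat) := ln (y i) + 2 * s * ln i%:R - (c1 + c2) / 2.
have rb i : (1 <= i <= n)%N -> - ((c2 - c1) / 2) <= r i <= (c2 - c1) / 2.
  move=> hi; have /andP[y1 y2] := hy i hi.
  have i0 : 0 < i%:R :> R by rewrite ltr0n; case/andP: hi.
  have p0 : 0 < i%:R `^ (- 2 * s) := powR_gt0 _ i0.
  have y0 : 0 < y i by rewrite (lt_le_trans _ y1) // mulr_gt0.
  have lnCp c : 0 < c -> ln (c * i%:R `^ (- 2 * s)) = ln c + - 2 * s * ln i%:R.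
    by move=> c0; rewrite lnM ?posrE // ln_powR.
  have := y1; rewrite -ler_ln ?posrE ?mulr_gt0 // lnCp // -/c1.
  have := y2; rewrite -ler_ln ?posrE ?mulr_gt0 // lnCp // -/c2.
  rewrite /r; lra.
(* The bounds at the single index 1 already order the two constants. *)
have c12 : 0 <= c2 - c1.
  have /rb/andP[] : (1 <= 1 <= n)%N by [].
  lra.
(* [K] is Cov(L, r): since L - A has mean zero, r need not be centred by its own mean, and
   Cauchy-Schwarz can use the plain bound on the mean of r^2. *)
pose Er := wsum n r; pose K := wsum n (fun i => (ln i%:R - A) * r i).
have Er1 : - ((c2 - c1) / 2) <= Er.
  by rewrite -(wsum_cst (- _) n0); apply: wsum_le => i /rb/andP[].
have Er2 : Er <= (c2 - c1) / 2.
  by rewrite -(wsum_cst (_ / _) n0); apply: wsum_le => i /rb/andP[].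
have Er_sqr : wsum n (fun i => r i ^+ 2) <= ((c2 - c1) / 2) ^+ 2.
  rewrite -(wsum_cst (_ ^+ 2) n0); apply: wsum_le => i /rb/andP[? ?].
  rewrite -[r i ^+ 2]real_normK ?num_real // ler_sqr ?nnegrE //; last by lra.
  by rewrite ler_norml; apply/andP.
have VE : wsum n (fun i => (ln i%:R - A) ^+ 2) = B - A ^+ 2.
  rewrite (@eq_wsum _ _ _ (fun i => ln i%:R ^+ 2 + ((- 2 * A) * ln i%:R
    + A ^+ 2))); last by move=> i _; ring.
  by rewrite !(wsumD, wsumZ) wsum_cst // -/A -/B; ring.
have ErE : Er = E + 2 * s * A - (c1 + c2) / 2.
  by rewrite /Er /r !(wsumD, wsumZ) wsum_cst.
have KE : K = C - A * E + 2 * s * (B - A ^+ 2).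
  rewrite /K (@eq_wsum _ _ _ (fun i => ln i%:R * ln (y i)
    + ((- A) * ln (y i) + ((2 * s) * ln i%:R ^+ 2
    + ((- 2 * s * A - (c1 + c2) / 2) * ln i%:R + A * (c1 + c2) / 2))))).
    by rewrite !(wsumD, wsumZ) wsum_cst // -/A -/B -/C -/E; field.
  by move=> i _; rewrite /r; field.
have K2 : K ^+ 2 <= (B - A ^+ 2) * ((c2 - c1) / 2) ^+ 2.
  rewrite -VE; apply: le_trans (wsum_cauchy_schwarz _ _) _; rewrite VE //.
  by rewrite ler_pM2l.
have ts : t - s = - (K / (2 * (B - A ^+ 2))).
  by rewrite ht KE; field; rewrite gt_eqF.
(* The fitted line passes through the point of means, d = E + 2tA; substituting E in terms of [Er]
   gives this form. *)
have dE : d = Er + (c1 + c2) / 2 + 2 * (t - s) * A.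
  by rewrite ErE ht /d; field; rewrite gt_eqF.
have tsl : `|t - s| * ln n%:R <= 4 * (c2 - c1).
  rewrite -ler_sqr ?nnegrE; [|by rewrite mulr_ge0 // ltW|lra].
  rewrite exprMn real_normK ?num_real //.
  (* With (t - s)^2 = K^2/(4 V^2) the middle term is 64 K^2/V, at most 64 Delta^2/4 = (4
     Delta)^2. *)
  apply: le_trans (_ : (t - s) ^+ 2 * (256 * (B - A ^+ 2)) <= _).
    by rewrite ler_wpM2l ?sqr_ge0.
  have -> : (t - s) ^+ 2 * (256 * (B - A ^+ 2)) = 64 * (K ^+ 2 / (B - A ^+ 2)).
    by rewrite ts; field; rewrite gt_eqF.
  have : K ^+ 2 / (B - A ^+ 2) <= ((c2 - c1) / 2) ^+ 2.
    by rewrite ler_pdivrMr // mulrC.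
  by rewrite !expr2; lra.
split; first by rewrite ler_pdivlMr.
(* As 2A <= log n, this follows from [tsl]; the remaining part [Er + (c1 + c2) / 2] of log D lies in
   [c1, c2]. *)
have : `|2 * (t - s) * A| <= 4 * (c2 - c1).
  rewrite !normrM (ger0_norm A0) ger0_norm //; apply: le_trans tsl.
  rewrite mulrAC mulrC ler_wpM2l //; lra.
by rewrite dE ler_norml => /andP[? ?]; apply/andP; split; lra.
Qed.
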